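(* Let $\{(A_n,B_n)\}_{n\in\mathbb{Z}}$ be a stationary and ergodic sequence of pairs of real-valued random variables on a probability space $(\Omega,\mathcal{F},P)$. Suppose that $$\mathbb{E}[\log|A_n|]<0 \quad\text{and}\quad \mathbb{E}[\log^{+}|B_n|]<\infty,$$ where $\log^{+}x=\max\{\log x,0\}$. Then the nonlinear stochastic recurrence equation $$X_{n+1}=A_{n+1}\,|X_n|+B_{n+1},\qquad n\in\mathbb{Z},$$ has a unique stationary solution $\{X_n\}_{n\in\mathbb{Z}}$.
   Context: A stationary solution of the recurrence is a sequence of real random variables $\{X_n\}_{n\in\mathbb{Z}}$, defined on the same probability space, satisfying the recurrence almost surely for every $n\in\mathbb{Z}$, whose finite-dimensional distributions are invariant under time shifts. Uniqueness is understood almost surely: any two stationary solutions coincide for all $n$ almost surely. This recurrence arises from the $p$-order cloud model, in which the $A_n$ are standard normal random variables. *)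

(* Defs.v *)
From HB Require Import structures.
From mathcomp Require Import all_boot all_order all_algebra.
From mathcomp Require Import all_classical all_reals all_analysis.
Set Implicit Arguments. Unset Strict Implicit. Unset Printing Implicit Defensive.
Import Order.TTheory GRing.Theory Num.Theory.
Local Open Scope classical_set_scope.
Local Open Scope ring_scope.

Section Defs.
Context {d : measure_display} {T : measurableType d} {R : realType}.

Definition cyl (X : int -> T -> R) (m : int) (s : seq (int * set R)) : set T :=
  \bigcap_(p in [set p | p \in s]) (X (p.1 + m)%R @^-1` p.2).

Definition borel_list (s : seq (int * set R)) : Prop :=
  forall p, p \in s -> measurable p.2.

(* Strict stationarity of a real process: its finite-dimensional distributions
   are invariant under time shifts (equality on all finite-dimensional
   measurable rectangles, which determine the finite-dimensional laws). *)
Definition stationary (P : probability T R) (X : int -> T -> R) : Prop :=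
  forall (s : seq (int * set R)) (m : int), borel_list s ->
    P (cyl X m s) = P (cyl X 0 s).

Definition stationary2 (P : probability T R) (A B : int -> T -> R) : Prop :=
  forall (s t : seq (int * set R)) (m : int), borel_list s -> borel_list t ->
    P (cyl A m s `&` cyl B m t) = P (cyl A 0 s `&` cyl B 0 t).

Definition coord_events : set (set (int -> R * R)) :=
  [set S | exists (i : int) (C : set R), measurable C /\
      (S = [set s | (s i).1 \in C] \/ S = [set s | (s i).2 \in C])].

Definition path_measurable (S : set (int -> R * R)) : Prop :=
  <<s coord_events >> S.

Definition shift (s : int -> R * R) : int -> R * R := fun n => s (n + 1)%R.

Definition path (A B : int -> T -> R) (w : T) : int -> R * R :=
  fun n => (A n w, B n w).

Definition ergodic2 (P : probability T R) (A B : int -> T -> R) : Prop :=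
  forall S : set (int -> R * R), path_measurable S -> shift @^-1` S = S ->
    P (path A B @^-1` S) = 0%E \/ P (path A B @^-1` S) = 1%E.

Definition elogabs (x : R) : \bar R :=
  if x == 0 then -oo%E else (ln `|x|)%:E.

Definition logplus_abs (x : R) : R := Num.max (ln `|x|) 0.

Definition stationary_solution (P : probability T R) (A B X : int -> T -> R)
  : Prop :=
  (forall n, measurable_fun setT (X n)) /\
  (forall n : int, {ae P, forall w, X (n + 1)%R w = A (n + 1)%R w * `|X n w| + B (n + 1)%R w}) /\
  stationary P X.

End Defs.

(* Main.v *)
Require Import Defs.
From HB Require Import structures.
From mathcomp Require Import all_boot all_order all_algebra.
From mathcomp Require Import all_classical all_reals all_analysis.
From mathcomp Require Import measurable_realfun ring lra.
Import Order.TTheory GRing.Theory Num.Theory.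
Import numFieldNormedType.Exports.
Local Open Scope classical_set_scope.
Local Open Scope ring_scope.

(* Put h = log^+|B|.  By monotone convergence one can choose K and e > 0 such
   that g = max(log|A|, -K) + (h - K)^+ + e has negative mean.  If the maxima
   over n of the backward sums g_0 + g_(-1) + ... + g_(-n+1) were unbounded
   with positive probability, they would be unbounded almost surely by
   ergodicity, and the maximal ergodic inequality would give E g >= 0.  So
   these sums are almost surely bounded above, which makes both
   |A_0 ... A_(-k+1)| and |A_0 ... A_(-k+1) B_(-k)| decay geometrically: the
   (h - K)^+ part of g absorbs |B_(-k)|, so no separate Borel-Cantelli argument
   is needed.  As x |-> a|x| + b is |a|-Lipschitz, the iterates started from 0
   at time -k converge, and their limit, read along the shifted path, is a
   stationary solution.  Two solutions satisfy
   |X_n - Y_n| <= |A_n ... A_(n-k+1)| |X_(n-k) - Y_(n-k)|, where the first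
   factor tends to 0 and, both processes being stationary, the second is
   tight. *)

(** * The maximal ergodic inequality for a measure-preserving map *)

Section MeasurePreserving.
Context {d : measure_display} {T : measurableType d} {R : realType}.
Variables (mu : {measure set T -> \bar R}) (theta : T -> T).
Hypothesis mtheta : measurable_fun setT theta.
Hypothesis theta_inv : forall S, measurable S -> mu (theta @^-1` S) = mu S.

Lemma ge0_integral_comp_preserving (f : T -> \bar R) :
  measurable_fun setT f -> (forall u, 0 <= f u)%E ->
  (\int[mu]_u f (theta u) = \int[mu]_u f u)%E.
Proof.
move=> mf f0; rewrite -[LHS]/(\int[mu]_(u in theta @^-1` setT) (f \o theta) u)%E.
rewrite -(ge0_integral_pushforward mtheta)//.
by apply: eq_measure_integral => S mS _; exact: theta_inv.
Qed.

Section MaximalErgodic.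
Variables p q : T -> R.
Hypotheses (mp : measurable_fun setT p) (mq : measurable_fun setT q).
Hypotheses (p0 : forall u, 0 <= p u) (q0 : forall u, 0 <= q u).

(* [max_sum n u] is the maximum of the sums of [q - p] over the first [k <= n]
   points of the orbit of [u]. *)
Fixpoint max_sum n u :=
  if n is m.+1 then Num.max 0 (q u - p u + max_sum m (theta u)) else 0.

Lemma max_sum_ge0 n u : 0 <= max_sum n u.
Proof. by case: n => //= n; rewrite le_max lexx. Qed.

Lemma max_sumS n u : max_sum n u <= max_sum n.+1 u.
Proof.
elim: n u => [u|n IH u]; first exact: max_sum_ge0.
by rewrite [leLHS]/= [leRHS]/= ge_max !le_max lexx/= lerD2l IH orbT.
Qed.

Lemma nd_max_sum m n u : (m <= n)%N -> max_sum m u <= max_sum n u.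
Proof. by apply: (@homo_leq _ (max_sum^~ u) _ lexx le_trans) => k; exact: max_sumS. Qed.

Lemma measurable_max_sum n : measurable_fun setT (max_sum n).
Proof.
elim: n => [|n IH]; first exact: measurable_cst.
apply: measurable_maxr; first exact: measurable_cst.
by apply: measurable_funD; [exact: measurable_funB|exact: measurableT_comp].
Qed.

Hypothesis q_fin : (\int[mu]_u (q u)%:E < +oo)%E.

Let int_theta n : (\int[mu]_u (max_sum n (theta u))%:E = \int[mu]_u (max_sum n u)%:E)%E.
Proof.
apply: (ge0_integral_comp_preserving (fun u => (max_sum n u)%:E)) => //.
  by apply/measurable_EFinP; exact: measurable_max_sum.
by move=> u; rewrite lee_fin max_sum_ge0.
Qed.

Definition max_sum_pos n := [set u | 0 < max_sum n u].

Lemma measurable_max_sum_pos n : measurable (max_sum_pos n).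
Proof.
rewrite (_ : max_sum_pos n = setT `&` max_sum n @^-1` `]0, +oo[%classic); last first.
  by apply/seteqP; split => u /=; rewrite in_itv/= andbT // => -[].
exact: measurable_max_sum.
Qed.

(** Where [max_sum n.+1] is positive, adding [p] to it gives exactly [q] plus [max_sum n] at
    [theta u]; elsewhere the left integrand is 0. Integrating and using invariance gives the bound.
    Keeping [p] and [q] on opposite sides leaves only integrals of nonnegative functions. *)
Let key n :
  (\int[mu]_u (max_sum n.+1 u)%:E + \int[mu]_(u in max_sum_pos n.+1) (p u)%:E
   <= \int[mu]_u (q u)%:E + \int[mu]_u (max_sum n u)%:E)%E.
Proof.
have mM k : measurable_fun setT (EFin \o max_sum k).
  by apply/measurable_EFinP; exact: measurable_max_sum.
have mMt k : measurable_fun setT (EFin \o (max_sum k \o theta)).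
  by apply/measurable_EFinP; apply: measurableT_comp => //; exact: measurable_max_sum.
have mp' : measurable_fun setT ((EFin \o p) \_ (max_sum_pos n.+1)).
  apply/(measurable_restrictT _ _).1; first exact: measurable_max_sum_pos.
  by apply: measurable_funTS; exact/measurable_EFinP.
have p0' u : (0 <= ((EFin \o p) \_ (max_sum_pos n.+1)) u)%E.
  by rewrite erestrict_ge0// => ? _; rewrite lee_fin.
rewrite -(int_theta n) [in X in (_ + X)%E]integral_mkcond.
rewrite -ge0_integralD//; last 2 first.
- by move=> u _; rewrite lee_fin max_sum_ge0.
- exact: mM.
rewrite -ge0_integralD//; last 4 first.
- by move=> u _; rewrite lee_fin.
- exact/measurable_EFinP.
- by move=> u _; rewrite lee_fin max_sum_ge0.
- exact: mMt.
apply: ge0_le_integral => //.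
- by move=> u _; rewrite adde_ge0// lee_fin max_sum_ge0.
- by apply: emeasurable_funD => //; exact: mM.
- by apply: emeasurable_funD => //; [exact/measurable_EFinP|exact: mMt].
move=> u _; rewrite patchE; case: ifPn => /= [|_].
  rewrite inE /max_sum_pos/= lt_max ltxx/= => h.
  by rewrite max_r ?(ltW h)// lee_fin; lra.
rewrite [X in (_ + X)%E](_ : _ = 0%E)// adde0 lee_fin ge_max addr_ge0 ?max_sum_ge0//=.
by have := p0 u; lra.
Qed.

Lemma integral_max_sum_fin n : (\int[mu]_u (max_sum n u)%:E < +oo)%E.
Proof.
elim: n => [|n IH]; first by rewrite integral0.
apply: (@le_lt_trans _ _ (\int[mu]_u (q u)%:E + \int[mu]_u (max_sum n u)%:E)%E).
  apply: le_trans (key n); rewrite leeDl// integral_ge0// => u _.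
  by rewrite lee_fin.
by rewrite lte_add_pinfty.
Qed.

(** Since [max_sum n <= max_sum n.+1] and both have finite integral, these integrals cancel in
    [key]. Integrating [q] over the whole space loses nothing in the limit, where the sets on the
    left exhaust the space up to a null set. *)
Lemma maximal_ergodic_ineq n :
  (\int[mu]_(u in max_sum_pos n.+1) (p u)%:E <= \int[mu]_u (q u)%:E)%E.
Proof.
have fin k : (\int[mu]_u (max_sum k u)%:E)%E \is a fin_num.
  rewrite ge0_fin_numE ?integral_max_sum_fin// integral_ge0// => u _.
  by rewrite lee_fin max_sum_ge0.
rewrite -(leeD2lE _ _ (fin n.+1)); apply: le_trans (key n) _.
rewrite addeC leeD2rE//; last first.
  rewrite ge0_fin_numE// integral_ge0// => u _; by rewrite lee_fin.
apply: ge0_le_integral => //.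
- by move=> u _; rewrite lee_fin max_sum_ge0.
- by apply/measurable_EFinP; exact: measurable_max_sum.
- by apply/measurable_EFinP; exact: measurable_max_sum.
- by move=> u _; rewrite lee_fin; exact: max_sumS.
Qed.

Hypothesis ergodic : forall S, measurable S -> theta @^-1` S = S ->
  mu S = 0%E \/ mu (~` S) = 0%E.
Hypothesis lt_pq : (\int[mu]_u (q u)%:E < \int[mu]_u (p u)%:E)%E.

Definition max_sum_unbounded := [set u | forall K : nat, exists n, K%:R < max_sum n u].

Lemma measurable_max_sum_unbounded : measurable max_sum_unbounded.
Proof.
rewrite (_ : max_sum_unbounded =
  \bigcap_K \bigcup_n (setT `&` max_sum n @^-1` `]K%:R, +oo[%classic)); last first.
  apply/seteqP; split => u /=.
    move=> h K _; have [n Kn] := h K; exists n => //=.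
    by rewrite in_itv/= andbT Kn.
  move=> h K; have [n _ [_]] := h K Logic.I; rewrite /= in_itv/= andbT => Kn.
  by exists n.
apply: bigcapT_measurable => K; apply: bigcupT_measurable => n.
exact: measurable_max_sum.
Qed.

(** Passing from [u] to [theta u] changes the sums by the single term [q u - p u], which a larger
    threshold absorbs. The sets are equal exactly, not only almost surely, as [ergodic] requires. *)
Lemma max_sum_unbounded_invariant : theta @^-1` max_sum_unbounded = max_sum_unbounded.
Proof.
apply/seteqP; split => u /= h K.
  have [n hn] : exists n, K%:R + `|q u - p u| < max_sum n (theta u).
    have [n hn] := h (K + Num.bound `|q u - p u|%R)%N.
    exists n; apply: le_lt_trans hn.
    by rewrite natrD lerD2l ltW// archi_boundP.
  exists n.+1 => /=; rewrite lt_max; apply/orP; right.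
  by have := ler_norm (- (q u - p u)); rewrite normrN; lra.
have [[|n] hn] := h (K + Num.bound `|q u - p u|%R)%N.
  by have := ler0n R (K + Num.bound `|q u - p u|%R); move: hn => /=; lra.
exists n; move: hn; rewrite /= natrD lt_max.
have := archi_boundP (normr_ge0 (q u - p u)); have := ler_norm (q u - p u).
have := normr_ge0 (q u - p u); have := ler0n R K.
by move=> ? ? ? ? /orP[] ?; lra.
Qed.

Lemma ae_max_sum_bounded : {ae mu, forall u, exists C : R, forall n, max_sum n u <= C}.
Proof.
have [E0|E0] := ergodic _ measurable_max_sum_unbounded max_sum_unbounded_invariant.
  exists max_sum_unbounded; split => //; first exact: measurable_max_sum_unbounded.
  move=> u /= nb K; apply: contrapT => hn; apply: nb; exists K%:R => n.
  by rewrite leNgt; apply/negP => ?; apply: hn; exists n.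
(* Now the sums are unbounded almost everywhere, so the increasing sets [max_sum_pos n.+1] cover
   almost every point. Monotone convergence in the maximal inequality then contradicts [lt_pq]. *)
suff: (\int[mu]_u (p u)%:E <= \int[mu]_u (q u)%:E)%E by rewrite leNgt lt_pq.
pose f n := (EFin \o p) \_ (max_sum_pos n.+1).
pose g := (EFin \o p) \_ (\bigcup_n max_sum_pos n.+1).
have mP n := measurable_max_sum_pos n.
have -> : (\int[mu]_u (p u)%:E = \int[mu]_u g u)%E.
  apply: ae_eq_integral => //; [exact/measurable_EFinP| |].
    apply/(measurable_restrictT _ _).1; first exact: bigcupT_measurable.
    by apply: measurable_funTS; exact/measurable_EFinP.
  exists (~` max_sum_unbounded); split => //.
    by apply: measurableC; exact: measurable_max_sum_unbounded.
  move=> u /= nu hu; apply: nu => _; rewrite /g patchE mem_set//.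
  have [[|n] hn] := hu 0%N; first by move: hn; rewrite /= ltxx.
  by exists n.
have cvg_fg : (\int[mu]_u f n u @[n --> \oo] --> \int[mu]_u g u)%E.
  have nd_pos : {homo (fun n => max_sum_pos n.+1) : m n / (m <= n)%N >-> m `<=` n}.
    by move=> m n mn u h; apply: lt_le_trans h _; exact: (@nd_max_sum m.+1 n.+1).
  have : forall u, f n u @[n --> \oo] --> g u.
    move=> u; rewrite /g patchE; case: ifPn => [|nu].
      rewrite inE => -[n _ hn]; apply: cvg_near_cst.
      exists n => // m /= nm; rewrite /f patchE mem_set//; exact: (nd_pos _ _ nm).
    apply: cvg_near_cst; apply: nearW => n; rewrite /f patchE ifN//.
    by apply: contra nu; rewrite !inE => hn; exists n.
  move=> /= fg.
  have -> : (\int[mu]_u g u = \int[mu]_u limn (f ^~ u))%E.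
    by apply: eq_integral => u _; apply/esym/cvg_lim => //; exact: fg.
  apply: cvg_monotone_convergence => //.
  - move=> n; apply/(measurable_restrictT _ _).1 => //.
    by apply: measurable_funTS; exact/measurable_EFinP.
  - by move=> n u _; rewrite /f erestrict_ge0// => ? _; rewrite lee_fin.
  - move=> u _ m n mn; rewrite /f !patchE; case: ifPn.
      by rewrite inE => /(nd_pos _ _ mn) h; rewrite mem_set.
    by case: ifPn => // _ _; rewrite lee_fin.
rewrite -(cvg_lim _ cvg_fg)//; apply: lime_le; first by apply/cvg_ex; eexists; exact: cvg_fg.
by apply: nearW => n; rewrite /f -integral_mkcond; exact: maximal_ergodic_ineq.
Qed.

End MaximalErgodic.
End MeasurePreserving.

(** * Backward iterates of the recurrence and their limit *)

Section BackwardIteration.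
Context {d : measure_display} {T : measurableType d} {R : realType}.
Variables (theta : T -> T) (a b : T -> R).

(** With [theta] the backward shift this is [|A_0 ... A_(-k+1)|]. *)
Definition orbit_prod k u := \prod_(i < k) `|a (iter i theta u)|.

Lemma orbit_prodS k u : orbit_prod k.+1 u = `|a u| * orbit_prod k (theta u).
Proof.
rewrite /orbit_prod big_ord_recl; congr (_ * _).
by apply: eq_bigr => i _; rewrite /= /bump -iterSr.
Qed.

(** The value at time 0 of the recurrence started from 0 at time [-k]. *)
Fixpoint backward_iter k u :=
  if k is m.+1 then a u * `|backward_iter m (theta u)| + b u else 0.

(** Both iterates apply the same [k] Lipschitz maps, one to [b (iter k theta u)] and the other to 0;
    the Lipschitz constants multiply to [orbit_prod k u]. *)
Lemma backward_iter_dist k u :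
  `|backward_iter k.+1 u - backward_iter k u|
    <= orbit_prod k u * `|b (iter k theta u)|.
Proof.
elim: k u => [|k IH] u.
  by rewrite /= normr0 mulr0 add0r subr0 /orbit_prod big_ord0 mul1r.
rewrite orbit_prodS -mulrA iterSr.
have -> : backward_iter k.+2 u - backward_iter k.+1 u = a u *
   (`|backward_iter k.+1 (theta u)| - `|backward_iter k (theta u)|).
  by rewrite /=; ring.
rewrite normrM ler_wpM2l//; apply: le_trans (IH _); exact: ler_dist_dist.
Qed.

(** [C] may depend on the path, [rho] does not. The first bound serves uniqueness, the second
    existence. *)
Definition geometric_decay rho u := exists C, forall k,
  orbit_prod k u <= C * rho ^+ k /\
  orbit_prod k u * `|b (iter k theta u)| <= C * rho ^+ k.

Lemma is_cvg_backward_iter rho u : 0 <= rho < 1 ->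
  geometric_decay rho u -> cvgn (backward_iter ^~ u).
Proof.
move=> /andP[rho0 rho1] [C hC].
have -> : backward_iter ^~ u = series (telescope (backward_iter ^~ u)).
  by rewrite telescopeK; apply/funext => n /=; rewrite subr0.
apply: normed_cvg; apply: (@series_le_cvg _ _ (geometric C rho)) => //.
- by move=> n /=.
- move=> n /=; apply: le_trans (hC n).2; rewrite mulr_ge0//; exact: prodr_ge0.
- by move=> n; apply: le_trans (hC n).2; exact: backward_iter_dist.
- by apply: is_cvg_geometric_series; rewrite ger0_norm.
Qed.

(** The upper limit makes this a total measurable function, equal to the limit wherever the iterates
    converge. *)
Definition backward_lim u := fine (limn_esup (fun k => (backward_iter k u)%:E)).

Lemma backward_limE u : cvgn (backward_iter ^~ u) ->
  backward_lim u = limn (backward_iter ^~ u).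
Proof.
move=> /cvg_ex[l hl]; rewrite (cvg_lim _ hl)//.
have h : (backward_iter k u)%:E @[k --> \oo] --> l%:E.
  by apply: cvg_EFin; [exact: nearW|exact: hl].
by rewrite /backward_lim is_cvg_limn_esupE ?(cvg_lim _ h)//; apply/cvg_ex; exists l%:E.
Qed.

Lemma backward_lim_rec u : cvgn (backward_iter ^~ u) ->
  cvgn (backward_iter ^~ (theta u)) ->
  backward_lim u = a u * `|backward_lim (theta u)| + b u.
Proof.
move=> hu hv; rewrite !backward_limE//.
have hu' : backward_iter k.+1 u @[k --> \oo] --> limn (backward_iter ^~ u).
  by rewrite (cvg_shiftS (backward_iter ^~ u)).
rewrite -(cvg_lim _ hu')//; apply/cvg_lim => //=.
by apply: cvgD; [apply: cvgM; [exact: cvg_cst|exact: cvg_norm hv]|exact: cvg_cst].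
Qed.

Hypotheses (ma : measurable_fun setT a) (mb : measurable_fun setT b).
Hypothesis mtheta : measurable_fun setT theta.

Lemma measurable_backward_lim : measurable_fun setT backward_lim.
Proof.
apply: (measurableT_comp (fine_measurable _)) => //.
apply: measurable_fun_limn_esup => k; apply/measurable_EFinP.
elim: k => [|k IH]; first exact: measurable_cst.
apply: measurable_funD => //; apply: measurable_funM => //.
by apply: measurableT_comp => //; exact: measurableT_comp.
Qed.

Variables (p q : T -> R) (e L : R).
Hypothesis ha : forall u, `|a u| <= expR (q u - p u - e).
Hypothesis hb : forall u, `|b u| <= expR (q u - p u - e + L).

Lemma orbit_prod_ge0 k u : 0 <= orbit_prod k u.
Proof. exact: prodr_ge0. Qed.

Lemma orbit_prod_le_max_sum k u :
  orbit_prod k u <= expR (max_sum theta p q k u - k%:R * e).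
Proof.
elim: k u => [|k IH] u; first by rewrite /orbit_prod big_ord0 mul0r subr0 expR0.
rewrite orbit_prodS; apply: (le_trans (ler_pM _ _ (ha u) (IH (theta u)))) => //.
  exact: orbit_prod_ge0.
rewrite -expRD ler_expR -natr1 /=.
have : q u - p u + max_sum theta p q k (theta u)
  <= Num.max 0 (q u - p u + max_sum theta p q k (theta u)) by rewrite le_max lexx orbT.
lra.
Qed.

(** The factor [b] is bounded like one more factor [a], up to [expR L]; hence the sum over [k.+1]
    orbit points. *)
Lemma orbit_prod_mul_le_max_sum k u : orbit_prod k u * `|b (iter k theta u)|
  <= expR (max_sum theta p q k.+1 u - k.+1%:R * e + L).
Proof.
have h j v : q v - p v + max_sum theta p q j (theta v)
  <= Num.max 0 (q v - p v + max_sum theta p q j (theta v)) by rewrite le_max lexx orbT.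
elim: k u => [|k IH] u.
  rewrite /orbit_prod big_ord0 mul1r /= (le_trans (hb u))// ler_expR.
  by have := h 0%N u; rewrite /=; lra.
rewrite orbit_prodS -mulrA iterSr.
apply: (le_trans (ler_pM _ _ (ha u) (IH (theta u)))) => //.
  by rewrite mulr_ge0// orbit_prod_ge0.
rewrite -expRD ler_expR -[k.+2%:R]natr1.
by have := h k.+1 u; rewrite -/(max_sum theta p q k.+2 u); lra.
Qed.

Lemma geometric_decay_of_max_sum u :
  (exists C : R, forall n, max_sum theta p q n u <= C) ->
  geometric_decay (expR (- e)) u.
Proof.
(* One constant for each bound; the extra [- e] comes from the additional orbit point in the
   second. *)
move=> [C hC]; exists (Num.max (expR C) (expR (C - e + L))) => k.
have rk : expR (- e) ^+ k = expR (- (k%:R * e)).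
  by rewrite -expRM_natl mulrN.
split.
  apply: (le_trans (orbit_prod_le_max_sum k u)).
  by rewrite [leLHS]expRD rk ler_wpM2r ?expR_ge0// le_max ler_expR hC.
apply: (le_trans (orbit_prod_mul_le_max_sum k u)).
have -> : max_sum theta p q k.+1 u - k.+1%:R * e + L =
   (max_sum theta p q k.+1 u - e + L) + - (k%:R * e) by rewrite -natr1; ring.
by rewrite [leLHS]expRD rk ler_wpM2r ?expR_ge0// le_max !ler_expR !lerD2r hC orbT.
Qed.

End BackwardIteration.

(** * Truncated logarithms of the coefficients *)

Section TruncatedLog.
Context {R : realType}.
Implicit Types (x y e K : R).

(* [logminus K x] is the negative part of [log |x|] truncated at [K]; the case
   split is needed because [ln 0 = 0]. *)
Definition logminus K x : R :=
  if x == 0 then K else Num.min (Num.max (- ln `|x|) 0) K.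

(** For [0 <= K], [gain e x y - drift K x y] is [max(log|x|, -K) + (log^+|y| - K)^+ + e], written as
    a difference of nonnegative functions to fit [q - p]. *)
Definition gain e x y := logplus_abs x + logplus_abs y + e.

Definition drift K x y := logminus K x + Num.min (logplus_abs y) K.

Lemma logplus_abs_ge0 x : 0 <= logplus_abs x.
Proof. by rewrite /logplus_abs le_max lexx orbT. Qed.

Lemma gain_ge0 e x y : 0 <= e -> 0 <= gain e x y.
Proof. by move=> e0; rewrite !addr_ge0// logplus_abs_ge0. Qed.

Lemma logminus_ge0 K x : 0 <= K -> 0 <= logminus K x.
Proof.
by move=> K0; rewrite /logminus; case: ifP => // _; rewrite le_min K0 le_max lexx orbT.
Qed.

Lemma drift_ge0 K x y : 0 <= K -> 0 <= drift K x y.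
Proof.
by move=> K0; rewrite addr_ge0 ?logminus_ge0// le_min K0 logplus_abs_ge0.
Qed.

Lemma normr_le_exp_gain_drift e K x y : 0 <= K ->
  `|x| <= expR (gain e x y - drift K x y - e).
Proof.
move=> K0; rewrite /gain /drift /logminus.
have [->|x0] := eqVneq x 0; first by rewrite normr0 expR_ge0.
rewrite -[leLHS]lnK ?posrE ?normr_gt0// ler_expR /logplus_abs.
move: (ln `|x|) (Num.max (ln `|y|) 0) => l h.
case: (leP l 0) => ?; case: (leP (- l) 0) => ?; case: (leP h K) => ?;
case: (leP _ K) => ?; lra.
Qed.

Lemma normr_le_exp_logplus y : `|y| <= expR (logplus_abs y).
Proof.
have [->|y0] := eqVneq y 0; first by rewrite normr0 expR_ge0.
by rewrite -[leLHS]lnK ?posrE ?normr_gt0// ler_expR /logplus_abs le_max lexx.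
Qed.

(** The drift is at most [2K], so adding [K *+ 2] leaves an exponent of at least [log^+|y|]. *)
Lemma normr_le_exp_gain_driftr e K x y : 0 <= K ->
  `|y| <= expR (gain e x y - drift K x y - e + K *+ 2).
Proof.
move=> K0; apply: (le_trans (normr_le_exp_logplus y)); rewrite ler_expR.
have xK : logminus K x <= K.
  by rewrite /logminus; case: ifP => // _; rewrite ge_min lexx orbT.
have yK : Num.min (logplus_abs y) K <= K by rewrite ge_min lexx orbT.
by have := logplus_abs_ge0 x; rewrite /gain /drift mulr2n; lra.
Qed.

Lemma measurable_lnabs : measurable_fun setT (fun x => ln `|x|).
Proof. by apply: measurableT_comp; [exact: measurable_ln|exact: normr_measurable]. Qed.

Lemma measurable_logplus_abs : measurable_fun setT (@logplus_abs R).
Proof. by apply: measurable_maxr; [exact: measurable_lnabs|exact: measurable_cst]. Qed.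

Lemma measurable_logminus K : measurable_fun setT (logminus K).
Proof.
apply: measurable_fun_ifT => //; first exact: measurable_fun_eqr.
apply: measurable_minr => //; apply: measurable_maxr => //.
by apply: measurableT_comp => //; exact: measurable_lnabs.
Qed.

Lemma measurable_elogabs : measurable_fun setT (@elogabs R).
Proof.
apply: measurable_fun_ifT => //; first exact: measurable_fun_eqr.
by apply/measurable_EFinP; exact: measurable_lnabs.
Qed.

Lemma elogabs_pos x : ((@elogabs R)^\+ x = (logplus_abs x)%:E)%E.
Proof.
rewrite funeposE /elogabs /logplus_abs; case: eqVneq => [->|x0].
  by rewrite maxNye normr0 ln0// maxxx.
by rewrite -EFin_max.
Qed.

(** At [x = 0] the truncation is [n] itself and tends to [+oo]; elsewhere the sequence is eventually
    constant. *)
Lemma logminus_cvg x : (logminus n%:R x)%:E @[n --> \oo] --> ((@elogabs R)^\- x)%E.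
Proof.
rewrite funenegE /elogabs /logminus; case: ifPn => _.
  by rewrite maxye; apply/cvgeryP; exact: cvgr_idn.
rewrite -EFinN -EFin_max; apply: cvg_near_cst.
exists (Num.bound (Num.max (- ln `|x|) 0)) => // n /= hn.
congr EFin; apply: min_l; apply: ltW; apply: (lt_le_trans (archi_boundP _)).
  by rewrite le_max lexx orbT.
by rewrite ler_nat.
Qed.

Lemma nd_logminus K K' x : K <= K' -> logminus K x <= logminus K' x.
Proof.
by move=> KK'; rewrite /logminus; case: ifP => // _; rewrite le_min2.
Qed.

End TruncatedLog.

(** * Choice of the truncation level and of the margin *)

Section DriftIntegral.
Context {d : measure_display} {T : measurableType d} {R : realType}.
Variables (P : probability T R) (A B : T -> R).
Hypotheses (mA : measurable_fun setT A) (mB : measurable_fun setT B).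
Hypothesis A_fin : (\int[P]_w (logplus_abs (A w))%:E < +oo)%E.
Hypothesis B_fin : (\int[P]_w (logplus_abs (B w))%:E < +oo)%E.
Hypothesis A_neg : (\int[P]_w elogabs (A w) < 0)%E.

Let mlogA : measurable_fun setT (fun w => (logplus_abs (A w))%:E).
Proof.
apply/measurable_EFinP; apply: measurableT_comp => //.
exact: measurable_logplus_abs.
Qed.

Let mlogB : measurable_fun setT (fun w => (logplus_abs (B w))%:E).
Proof.
apply/measurable_EFinP; apply: measurableT_comp => //.
exact: measurable_logplus_abs.
Qed.

Lemma measurable_drift K : measurable_fun setT (fun w => drift K (A w) (B w)).
Proof.
apply: measurable_funD.
  by apply: measurableT_comp => //; exact: measurable_logminus.
apply: measurable_minr => //.
by apply: measurableT_comp => //; exact: measurable_logplus_abs.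
Qed.

Lemma measurable_gain e : measurable_fun setT (fun w => gain e (A w) (B w)).
Proof.
apply: measurable_funD => //; apply: measurable_funD.
  by apply: measurableT_comp => //; exact: measurable_logplus_abs.
by apply: measurableT_comp => //; exact: measurable_logplus_abs.
Qed.

Let int_ge0 f : (0 <= \int[P]_w (logplus_abs (f w))%:E)%E.
Proof. by apply: integral_ge0 => w _; rewrite lee_fin logplus_abs_ge0. Qed.

Lemma integral_gain e : 0 <= e -> (\int[P]_w (gain e (A w) (B w))%:E =
  \int[P]_w (logplus_abs (A w))%:E + \int[P]_w (logplus_abs (B w))%:E + e%:E)%E.
Proof.
move=> e0; rewrite -[in X in (_ + X)%E](mule1 e%:E) -(probability_setT P) -integral_cst//.
rewrite -ge0_integralD//; last 2 first.
- by move=> w _; rewrite lee_fin logplus_abs_ge0.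
- by move=> w _; rewrite lee_fin logplus_abs_ge0.
rewrite -ge0_integralD//.
- by move=> w _; rewrite -EFinD lee_fin addr_ge0// logplus_abs_ge0.
- exact: emeasurable_funD.
Qed.

Lemma drift_integral_cvg : (\int[P]_w (drift n%:R (A w) (B w))%:E @[n --> \oo] -->
  \int[P]_w ((fun w => elogabs (A w))^\- w) + \int[P]_w (logplus_abs (B w))%:E)%E.
Proof.
have cvg_drift w : (drift n%:R (A w) (B w))%:E @[n --> \oo] -->
    ((fun w => elogabs (A w))^\- w + (logplus_abs (B w))%:E)%E.
  under eq_fun do rewrite EFinD.
  apply: cvgeD; first by rewrite fin_num_adde_defl.
    by have := logminus_cvg (A w); rewrite !funenegE.
  apply: cvg_near_cst; exists (Num.bound (logplus_abs (B w))) => // n /= hn.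
  congr EFin; apply: min_l; apply: ltW.
  apply: (lt_le_trans (archi_boundP (logplus_abs_ge0 _))).
  by rewrite ler_nat.
rewrite -ge0_integralD//; last 2 first.
- by apply: measurable_funeneg; apply: measurableT_comp => //; exact: measurable_elogabs.
- by move=> w _; rewrite lee_fin logplus_abs_ge0.
have -> : (\int[P]_w ((fun w => elogabs (A w))^\- w + (logplus_abs (B w))%:E)
   = \int[P]_w limn (fun n => (drift n%:R (A w) (B w))%:E))%E.
  by apply: eq_integral => w _; apply/esym/cvg_lim => //; exact: cvg_drift.
apply: cvg_monotone_convergence => //.
- by move=> n; apply/measurable_EFinP; exact: measurable_drift.
- by move=> n w _; rewrite lee_fin drift_ge0.
- move=> w _ m n mn; rewrite lee_fin lerD ?nd_logminus ?ler_nat//.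
  by rewrite le_min2// ler_nat.
Qed.

(** As [K] grows, the mean drift tends to [E log^-|A| + E log^+|B|], possibly infinite. Since
    [E log|A| < 0], this exceeds [E log^+|A| + E log^+|B|], so some finite [K] already does, with
    room for a margin [e]. *)
Lemma exists_gain_lt_drift : exists K e, [/\ 0 <= K, 0 < e,
  (\int[P]_w (gain e (A w) (B w))%:E < +oo)%E &
  (\int[P]_w (gain e (A w) (B w))%:E < \int[P]_w (drift K (A w) (B w))%:E)%E].
Proof.
have [K cK] : exists n : nat, (\int[P]_w (logplus_abs (A w))%:E +
    \int[P]_w (logplus_abs (B w))%:E < \int[P]_w (drift n%:R (A w) (B w))%:E)%E.
  apply: contrapT => /forallNP no.
  have : (\int[P]_w ((fun w => elogabs (A w))^\- w) + \int[P]_w (logplus_abs (B w))%:E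
     <= \int[P]_w (logplus_abs (A w))%:E + \int[P]_w (logplus_abs (B w))%:E)%E.
    rewrite -(cvg_lim _ drift_integral_cvg)//; apply: lime_le.
      by apply/cvg_ex; eexists; exact: drift_integral_cvg.
    by apply: nearW => n; rewrite leNgt; apply/negP; exact: no.
  rewrite leeD2rE ?ge0_fin_numE// leNgt => /negP; apply.
  move: A_neg; rewrite integralE.
  have -> : (\int[P]_w ((fun w => elogabs (A w))^\+ w) = \int[P]_w (logplus_abs (A w))%:E)%E.
    by apply: eq_integral => w _; rewrite -elogabs_pos !funeposE.
  have cA : (\int[P]_w (logplus_abs (A w))%:E)%E \is a fin_num by rewrite ge0_fin_numE.
  rewrite -(fineK cA); move: (fine _) => c; case: (integral _ _ _) => [r||] //=.
    by rewrite -EFinB !lte_fin subr_lt0.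
  by rewrite ltry.
have cfin : (\int[P]_w (logplus_abs (A w))%:E + \int[P]_w (logplus_abs (B w))%:E)%E \is a fin_num.
  by rewrite fin_numD !ge0_fin_numE// A_fin B_fin.
exists K%:R.
have [e e0 he] : exists2 e, 0 < e & (\int[P]_w (logplus_abs (A w))%:E +
    \int[P]_w (logplus_abs (B w))%:E + e%:E < \int[P]_w (drift K%:R (A w) (B w))%:E)%E.
  (* The margin is half of the gap, or 1 in the branch of an infinite integral. *)
  move: cK; rewrite -(fineK cfin); move: (fine _) => c; case: (integral _ _ _) => [r||] //=.
    rewrite lte_fin => h; exists ((r - c) / 2); first by rewrite divr_gt0// subr_gt0.
    by rewrite -EFinD lte_fin; lra.
  by move=> _; exists 1 => //; rewrite -EFinD ltry.
by exists e; split => //; rewrite integral_gain ?(ltW e0)// -(fineK cfin) -EFinD ltry.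
Qed.
End DriftIntegral.

(** * Finite-dimensional cylinders *)

Section Cylinders.
Context {d : measure_display} {T : measurableType d} {R : realType}.
Implicit Types (X : int -> T -> R) (s : seq (int * set R)).

Lemma cyl_cat X m s1 s2 : cyl X m (s1 ++ s2) = cyl X m s1 `&` cyl X m s2.
Proof.
apply/seteqP; split => w.
  by move=> h; split => p ps; apply: h; rewrite /= mem_cat ps ?orbT.
by move=> [h1 h2] p; rewrite /= mem_cat => /orP[/h1|/h2].
Qed.

Lemma borel_list_cat s1 s2 : borel_list s1 -> borel_list s2 -> borel_list (s1 ++ s2).
Proof. by move=> h1 h2 p; rewrite mem_cat => /orP[/h1|/h2]. Qed.

Lemma measurable_cyl X m s : (forall n, measurable_fun setT (X n)) ->
  borel_list s -> measurable (cyl X m s).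
Proof.
move=> mX bs; apply: fin_bigcap_measurable; first exact: finite_seq.
by move=> p ps; rewrite -[X in measurable X]setTI; apply: mX => //; exact: bs.
Qed.

Lemma cyl1 X m i C : cyl X m [:: (i, C)] = X (i + m) @^-1` C.
Proof.
apply/seteqP; split => w; first by move=> /(_ (i, C)); apply; rewrite /= mem_seq1.
by move=> h p /=; rewrite mem_seq1 => /eqP ->.
Qed.

Lemma cyl0 X m : cyl X m [::] = setT.
Proof. by apply/seteqP; split => // w _ p; rewrite /= in_nil. Qed.

End Cylinders.

(** * Path space and the law of the coefficients *)

Section PathSpace.
Context {R : realType}.

(** Its measurable sets are the [path_measurable] ones by construction, so [ergodic2] applies to
    them directly. *)
Definition path_space := g_sigma_algebraType (@coord_events R).

Definition shiftz (m : int) (u : path_space) : path_space := fun n => u (n + m).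

Lemma shiftz_add m n u : shiftz m (shiftz n u) = shiftz (m + n) u.
Proof. by apply/funext => k; rewrite /shiftz addrA. Qed.

Lemma shiftz0 u : shiftz 0 u = u.
Proof. by apply/funext => k; rewrite /shiftz addr0. Qed.

Lemma measurable_fst_coord i : measurable_fun setT (fun u : path_space => (u i).1).
Proof.
move=> _ C mC; rewrite setTI; apply: sub_sigma_algebra; exists i, C; split => //.
by left; apply/seteqP; split => u /=; rewrite in_setE.
Qed.

Lemma measurable_snd_coord i : measurable_fun setT (fun u : path_space => (u i).2).
Proof.
move=> _ C mC; rewrite setTI; apply: sub_sigma_algebra; exists i, C; split => //.
by right; apply/seteqP; split => u /=; rewrite in_setE.
Qed.

Lemma measurable_to_path_space d (T : measurableType d) (f : T -> path_space) :
  (forall n, measurable_fun setT (fun w => (f w n).1)) ->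
  (forall n, measurable_fun setT (fun w => (f w n).2)) ->
  measurable_fun setT f.
Proof.
move=> m1 m2; apply: (@measurability _ _ T path_space setT f (@coord_events R) erefl).
move=> _ [_ [i [C [mC [->|->]]]] <-].
  rewrite (_ : _ @^-1` _ = (fun w => (f w i).1) @^-1` C); first exact: m1.
  by apply/seteqP; split => u /=; rewrite in_setE.
rewrite (_ : _ @^-1` _ = (fun w => (f w i).2) @^-1` C); first exact: m2.
by apply/seteqP; split => u /=; rewrite in_setE.
Qed.

Lemma measurable_shiftz m : measurable_fun setT (shiftz m).
Proof.
apply: measurable_to_path_space => n; [exact: measurable_fst_coord|exact: measurable_snd_coord].
Qed.

Let fst_coord (i : int) (u : path_space) := (u i).1.
Let snd_coord (i : int) (u : path_space) := (u i).2.

(** The pi-system on which [stationary2] compares the laws; it contains the generators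
    [coord_events]. *)
Definition path_cylinders : set (set path_space) :=
  [set S | exists s t, [/\ borel_list s, borel_list t &
    S = cyl fst_coord 0 s `&` cyl snd_coord 0 t]].

Lemma measurable_path_cylinders : path_cylinders `<=` measurable.
Proof.
move=> _ [s [t [bs bt ->]]]; apply: measurableI; apply: measurable_cyl => //.
- exact: measurable_fst_coord.
- exact: measurable_snd_coord.
Qed.

Lemma setI_closed_path_cylinders : setI_closed path_cylinders.
Proof.
move=> _ _ [s [t [bs bt ->]]] [s' [t' [bs' bt' ->]]].
exists (s ++ s'), (t ++ t'); split; [exact: borel_list_cat..|].
by rewrite !cyl_cat setIACA.
Qed.

Lemma path_cylindersT : path_cylinders setT.
Proof. by exists [::], [::]; split => //; rewrite !cyl0 setIT. Qed.

Lemma coord_events_path_cylinders : coord_events `<=` path_cylinders.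
Proof.
move=> _ [i [C [mC [->|->]]]].
  exists [:: (i, C)], [::]; split => //; first by move=> p; rewrite mem_seq1 => /eqP ->.
  rewrite cyl0 setIT cyl1 addr0.
  by apply/seteqP; split => u /=; rewrite in_setE.
exists [::], [:: (i, C)]; split => //; first by move=> p; rewrite mem_seq1 => /eqP ->.
rewrite cyl0 setTI cyl1 addr0.
by apply/seteqP; split => u /=; rewrite in_setE.
Qed.

Section Law.
Context {d : measure_display} {T : measurableType d}.
Variables (P : probability T R) (A B : int -> T -> R).
Hypotheses (mA : forall n, measurable_fun setT (A n)).
Hypotheses (mB : forall n, measurable_fun setT (B n)).

Definition path_at m (w : T) : path_space := fun n => (A (n + m) w, B (n + m) w).

Lemma shiftz_path_at m n w : shiftz m (path_at n w) = path_at (m + n) w.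
Proof. exact: (shiftz_add m n (Defs.path A B w)). Qed.

Lemma measurable_path_at m : measurable_fun setT (path_at m).
Proof. by apply: measurable_to_path_space => n; [exact: mA|exact: mB]. Qed.

Definition path_rv m : {mfun T >-> path_space} :=
  HB.pack (path_at m) (isMeasurableFun.Build _ _ _ _ _ (measurable_path_at m)).

Hypothesis AB_stationary : stationary2 P A B.

(** The laws of the path and of its shift agree on a generating pi-system, hence on every measurable
    set. *)
Lemma path_at_stationary m S : measurable S ->
  P (path_at m @^-1` S) = P (path_at 0 @^-1` S).
Proof.
move=> mS; have coverT : \bigcup_(k : nat) [set: path_space] = setT.
  by rewrite bigcup_const.
apply: (@g_sigma_algebra_measure_unique _ R path_space path_cylinders
  measurable_path_cylinders (fun=> setT) (fun=> path_cylindersT)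
  coverT (distribution P (path_rv m)) (distribution P (path_rv 0))).
- exact: setI_closed_path_cylinders.
- move=> _ [s [t [bs bt ->]]].
  have h k : path_at k @^-1` (cyl fst_coord 0 s `&` cyl snd_coord 0 t) =
      cyl A k s `&` cyl B k t.
    apply/seteqP; split => w [h1 h2]; split => p ps.
    + by have := h1 p ps; rewrite /fst_coord/= addr0.
    + by have := h2 p ps; rewrite /snd_coord/= addr0.
    + by have := h1 p ps; rewrite /fst_coord/= addr0.
    + by have := h2 p ps; rewrite /snd_coord/= addr0.
  transitivity (P (cyl A m s `&` cyl B m t)); first by rewrite -h.
  by rewrite AB_stationary// -h.
- by move=> _; apply: (le_lt_trans (probability_le1 _ _)) => //; exact: ltry.
- by apply: (sub_smallest2r _ coord_events_path_cylinders) mS.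
Qed.

(** By stationarity, a null set of the law pulls back to a null event at every time [m]. *)
Lemma ae_path_at m (Q : path_space -> Prop) :
  {ae distribution P (path_rv 0), forall u, Q u} -> {ae P, forall w, Q (path_at m w)}.
Proof.
move=> [N [mN N0 QN]]; exists (path_at m @^-1` N); split.
- by rewrite -[X in measurable X]setTI; exact: measurable_path_at.
- by rewrite path_at_stationary.
- by move=> w nQ; exact: (QN (path_at m w)).
Qed.

Lemma law_shiftz m S : measurable S ->
  distribution P (path_rv 0) (shiftz m @^-1` S) = distribution P (path_rv 0) S.
Proof.
move=> mS; rewrite /distribution /pushforward/= -[RHS](path_at_stationary m)//.
suff -> : path_at m = shiftz m \o path_at 0 by [].
by apply/funext => w /=; rewrite shiftz_path_at addr0.
Qed.

End Law.
End PathSpace.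
Arguments path_space R : clear implicits.

(** * Almost sure statements over all integers, and tightness *)

Lemma ae_forall_int d (T : measurableType d) (R : realType)
  (mu : {measure set T -> \bar R}) (Q : int -> T -> Prop) :
  (forall n, {ae mu, forall w, Q n w}) -> {ae mu, forall w, forall n, Q n w}.
Proof.
move=> hQ.
have hp : {ae mu, forall w, forall n : nat, Q n%:Z w} by apply/ae_foralln => n; exact: hQ.
have hm : {ae mu, forall w, forall n : nat, Q (Negz n) w} by apply/ae_foralln => n; exact: hQ.
by apply: filterS2 hp hm => w h1 h2 [n|n].
Qed.

Section Tightness.
Context {d : measure_display} {T : measurableType d} {R : realType}.
Variables (P : probability T R) (X : int -> T -> R).
Hypotheses (mX : forall n, measurable_fun setT (X n)) (sX : stationary P X).

Lemma stationary_marginal n C : measurable C -> P (X n @^-1` C) = P (X 0 @^-1` C).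
Proof.
move=> mC; have := sX [:: (0, C)] n; rewrite !cyl1 add0r addr0; apply.
by move=> p; rewrite mem_seq1 => /eqP ->.
Qed.

Lemma measurable_norm_gt n (M : R) : measurable [set w | M < `|X n w|].
Proof.
rewrite (_ : [set w | _] = setT `&` (Num.norm \o X n) @^-1` `]M, +oo[%classic); last first.
  by apply/seteqP; split => w /=; rewrite in_itv/= andbT // => -[].
apply: measurableT_comp => //; exact: mX.
Qed.

(** The events [|X_0| > M] decrease to the empty set, so one [M] suffices at time 0; stationarity
    carries it to every [n]. *)
Lemma stationary_tight (e : R) : 0 < e ->
  exists M : nat, forall n, (P [set w | (M%:R < `|X n w|)%R] <= e%:E)%E.
Proof.
move=> e0; pose F (M : nat) := [set w | M%:R < `|X 0 w|].
have mF M : measurable (F M) by exact: measurable_norm_gt.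
have [M hM] : exists M, (P (F M) <= e%:E)%E.
  apply: contrapT => /forallNP no.
  have F0 : \bigcap_M F M = set0.
    apply/seteqP; split => // w /(_ (Num.bound `|X 0 w|) Logic.I).
    by rewrite /F/= ltNge ltW// archi_boundP.
  have cvgF : P \o F @ \oo --> P (\bigcap_M F M).
    apply: nonincreasing_cvg_mu => //.
    - by apply: (le_lt_trans (probability_le1 _ _)) => //; exact: ltry.
    - by rewrite F0.
    - move=> m n mn; apply/subsetPset => w; rewrite /F/=; apply: le_lt_trans.
      by rewrite ler_nat.
  have : (e%:E <= P (\bigcap_M F M))%E.
    rewrite -(cvg_lim _ cvgF)//; apply: lime_ge; first by apply/cvg_ex; eexists; exact: cvgF.
    by apply: nearW => n; rewrite ltW// ltNge; apply/negP; exact: no.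
  by rewrite F0 measure0 lee_fin leNgt e0.
exists M => n.
have mC : measurable [set x : R | M%:R < `|x|].
  rewrite (_ : [set x | _] = setT `&` Num.norm @^-1` `]M%:R, +oo[%classic); last first.
    by apply/seteqP; split => w /=; rewrite in_itv/= andbT // => -[].
  exact: normr_measurable.
by have := stationary_marginal n _ mC => /= ->.
Qed.

End Tightness.

Lemma measure_nd_bigcup_le d (T : measurableType d) (R : realType)
  (mu : {measure set T -> \bar R}) (F : (set T)^nat) c :
  (forall n, measurable (F n)) -> nondecreasing_seq F ->
  (forall n, mu (F n) <= c)%E -> (mu (\bigcup_n F n) <= c)%E.
Proof.
move=> mF ndF hc.
have h : mu \o F @ \oo --> mu (\bigcup_n F n).
  by apply: nondecreasing_cvg_mu => //; exact: bigcupT_measurable.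
rewrite -(cvg_lim _ h)//; apply: lime_le; first by apply/cvg_ex; eexists; exact: h.
exact: nearW.
Qed.

(** * Existence and uniqueness of the stationary solution *)

Section StationarySolution.
Context {d : measure_display} {T : measurableType d} {R : realType}.
Variables (P : probability T R) (A B : int -> T -> R).
Hypotheses (mA : forall n, measurable_fun setT (A n)).
Hypotheses (mB : forall n, measurable_fun setT (B n)).
Hypothesis AB_stationary : stationary2 P A B.

Local Notation path_at := (path_at A B).
Local Notation law := (distribution P (path_rv A B mA mB 0)).

(** The backward shift: its iterates read the coefficients into the past. *)
Let theta : path_space R -> path_space R := shiftz (- 1).
Let a (u : path_space R) : R := (u 0).1.
Let b (u : path_space R) : R := (u 0).2.

Let theta_path_at n w : theta (path_at n w) = path_at (n - 1) w.
Proof. by rewrite /theta shiftz_path_at addrC. Qed.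

Let a_path_at n w : a (path_at n w) = A n w.
Proof. by rewrite /a /= add0r. Qed.

Let b_path_at n w : b (path_at n w) = B n w.
Proof. by rewrite /b /= add0r. Qed.

Let mtheta : measurable_fun setT theta := measurable_shiftz (- 1).

Let theta_inv S : measurable S -> law (theta @^-1` S) = law S.
Proof. exact: law_shiftz. Qed.

(** The two shifts are inverse to each other, so a set invariant under the backward shift is
    invariant under the forward one. *)
Lemma law_ergodic : ergodic2 P A B ->
  forall S, measurable S -> theta @^-1` S = S -> law S = 0%E \/ law (~` S) = 0%E.
Proof.
move=> erg S mS invS.
have pathE : path_at 0 = Defs.path A B by apply/funext => w; exact: shiftz0.
have invS' : Defs.shift @^-1` S = S.
  rewrite -[in LHS]invS; apply/seteqP; split => u;
    by rewrite /= /theta -/(shiftz 1 u) shiftz_add addNr shiftz0.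
have [S0|S1] := erg S mS invS'; [left|right].
  by rewrite -[RHS]S0 -pathE.
by rewrite probability_setC// [X in (1 - X)%E](_ : _ = 1%E) ?subee// -[RHS]S1 -pathE.
Qed.

Lemma ae_geometric_decay :
  ergodic2 P A B ->
  (\int[P]_w (logplus_abs (A 0 w))%:E < +oo)%E ->
  (\int[P]_w elogabs (A 0 w) < 0)%E ->
  (\int[P]_w (logplus_abs (B 0 w))%:E < +oo)%E ->
  exists2 rho : R, 0 <= rho < 1 &
    {ae law, forall u, geometric_decay theta a b rho u}.
Proof.
move=> erg A_fin A_neg B_fin.
have [K [e [K0 e0 gfin gd]]] :=
  exists_gain_lt_drift P (A 0) (B 0) (mA 0) (mB 0) A_fin B_fin A_neg.
exists (expR (- e)); first by rewrite expR_ge0 expR_lt1 oppr_lt0.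
pose q u := gain e (a u) (b u); pose p u := drift K (a u) (b u).
have ma : measurable_fun setT a by exact: measurable_fst_coord.
have mb : measurable_fun setT b by exact: measurable_snd_coord.
have mp : measurable_fun setT p by exact: measurable_drift.
have mq : measurable_fun setT q by exact: measurable_gain.
have p0 u : 0 <= p u by exact: drift_ge0.
have q0 u : 0 <= q u by apply: gain_ge0; exact: ltW.
have intp : (\int[law]_u (p u)%:E = \int[P]_w (drift K (A 0 w) (B 0 w))%:E)%E.
  by rewrite ge0_integral_distribution//; exact/measurable_EFinP.
have intq : (\int[law]_u (q u)%:E = \int[P]_w (gain e (A 0 w) (B 0 w))%:E)%E.
  by rewrite ge0_integral_distribution//; exact/measurable_EFinP.
have lt_qp : (\int[law]_u (q u)%:E < \int[law]_u (p u)%:E)%E by rewrite intp intq.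
have q_fin : (\int[law]_u (q u)%:E < +oo)%E by rewrite intq.
have := ae_max_sum_bounded law theta mtheta theta_inv p q mp mq p0 q0
  q_fin (law_ergodic erg) lt_qp.
apply: filterS => u.
apply: (geometric_decay_of_max_sum theta a b p q e (K *+ 2)).
  by move=> v; exact: normr_le_exp_gain_drift.
by move=> v; exact: normr_le_exp_gain_driftr.
Qed.

Variable rho : R.
Hypothesis rho01 : 0 <= rho < 1.
Hypothesis decay : {ae law, forall u, geometric_decay theta a b rho u}.

(** [X_n] is one fixed measurable functional [V] of the path seen from time [n]: the recurrence
    passes to the limit, and stationarity is inherited from the coefficients. *)
Lemma stationary_solution_exists : exists X, stationary_solution P A B X.
Proof.
pose V := backward_lim theta a b.
have mV : measurable_fun setT V.
  by apply: measurable_backward_lim => //; [exact: measurable_fst_coord|exact: measurable_snd_coord].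
exists (fun n w => V (path_at n w)); split; [|split].
- by move=> n; apply: measurableT_comp => //; exact: measurable_path_at.
- move=> n.
  have h : {ae P, forall w, geometric_decay theta a b rho (path_at (n + 1) w)}.
    exact: (ae_path_at P A B mA mB AB_stationary (n + 1) _ decay).
  have h' : {ae P, forall w, geometric_decay theta a b rho (path_at n w)}.
    exact: (ae_path_at P A B mA mB AB_stationary n _ decay).
  apply: filterS2 h h' => w hw hw'.
  have th : theta (path_at (n + 1) w) = path_at n w by rewrite theta_path_at addrK.
  have := backward_lim_rec theta a b (path_at (n + 1) w).
  rewrite th a_path_at b_path_at; apply; exact: is_cvg_backward_iter rho01 _.
- move=> s m bs.
  pose W i (u : path_space R) := V (shiftz i u).
  (* A shifted cylinder of the solution is the preimage under [path_at k] of an event that does not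
     depend on [k]. *)
  have h k : cyl (fun n w => V (path_at n w)) k s = path_at k @^-1` (cyl W 0 s).
    apply/seteqP; split => w hw p ps; have := hw p ps;
      by rewrite /W /= shiftz_path_at addr0.
  rewrite !h; apply: (path_at_stationary P A B mA mB AB_stationary).
  apply: measurable_cyl => // n.
  by apply: measurableT_comp => //; exact: measurable_shiftz.
Qed.

Section Uniqueness.
Variables X Y : int -> T -> R.
Hypotheses (solX : stationary_solution P A B X) (solY : stationary_solution P A B Y).

Lemma solution_dist_le w k n :
  (forall i, X (i + 1) w = A (i + 1) w * `|X i w| + B (i + 1) w) ->
  (forall i, Y (i + 1) w = A (i + 1) w * `|Y i w| + B (i + 1) w) ->
  `|X n w - Y n w| <=
    orbit_prod theta a k (path_at n w) * `|X (n - k%:Z) w - Y (n - k%:Z) w|.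
Proof.
move=> hX hY; elim: k n => [|k IH] n.
  by rewrite /orbit_prod big_ord0 mul1r subr0.
rewrite orbit_prodS a_path_at theta_path_at -mulrA.
have -> : X n w - Y n w = A n w * (`|X (n - 1) w| - `|Y (n - 1) w|).
  by have := hX (n - 1); have := hY (n - 1); rewrite subrK => -> ->; ring.
rewrite normrM ler_wpM2l//; apply: (le_trans (ler_dist_dist _ _)).
have -> : n - k.+1%:Z = n - 1 - k%:Z by rewrite intS opprD addrA.
exact: IH.
Qed.

(** Where [X n] and [Y n] differ, the decaying product forces [|X_(n-k) - Y_(n-k)|] above any fixed
    bound for all large [k], and by tightness this has arbitrarily small probability. *)
Lemma solution_eq n : {ae P, forall w, X n w = Y n w}.
Proof.
have [mX [recX sX]] := solX; have [mY [recY sY]] := solY.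
have good : {ae P, forall w, geometric_decay theta a b rho (path_at n w) /\
   forall k, `|X n w - Y n w| <=
    orbit_prod theta a k (path_at n w) * `|X (n - k%:Z) w - Y (n - k%:Z) w|}.
  have h1 := ae_path_at P A B mA mB AB_stationary n _ decay.
  apply: filterS3 h1 (ae_forall_int _ _ _ _ _ recX) (ae_forall_int _ _ _ _ _ recY).
  by move=> w dw hX hY; split => // k; exact: solution_dist_le.
have [N [mN N0 QN]] := good.
have mZ i (M : R) : measurable [set w | M < `|X i w - Y i w|].
  by apply: (measurable_norm_gt (fun i w => X i w - Y i w)) => j; exact: measurable_funB.
exists [set w | 0 < `|X n w - Y n w|]; split => //; last first.
  by move=> w /=; rewrite normr_gt0 subr_eq0 => /eqP.
apply/eqP; rewrite eq_le measure_ge0 andbT; apply/lee_addgt0Pr => e e0.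
rewrite add0e.
have e20 : 0 < e / 2 by rewrite divr_gt0.
have [M1 hM1] := stationary_tight P X mX sX _ e20.
have [M2 hM2] := stationary_tight P Y mY sY _ e20.
(* A difference above [M] forces [|X| > M1] or [|Y| > M2], each of probability at most [e / 2]. *)
pose M : R := M1%:R + M2%:R.
pose F j := \bigcap_(k in [set k | (j <= k)%N])
  [set w | M < `|X (n - k%:Z) w - Y (n - k%:Z) w|].
have mF j : measurable (F j) by apply: bigcap_measurableType => k _; exact: mZ.
have sub : [set w | 0 < `|X n w - Y n w|] `<=` N `|` \bigcup_j F j.
  move=> w /= Dw; apply: contrapT => /not_orP[nN nF].
  have [[C hC] hk] : geometric_decay theta a b rho (path_at n w) /\
   forall k, `|X n w - Y n w| <=
    orbit_prod theta a k (path_at n w) * `|X (n - k%:Z) w - Y (n - k%:Z) w|.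
    by apply: contrapT => h; apply: nN; exact: QN.
  apply: nF.
  have /andP[r0 r1] := rho01.
  (* Beyond some [j], [C * M * rho ^+ k] is below [|X n w - Y n w|], so no [k >= j] can have its
     past difference at most [M]. *)
  have : geometric (C * M) rho k @[k --> \oo] --> 0.
    by apply: cvg_geometric; rewrite ger0_norm.
  move=> /cvgr_lt /(_ _ Dw) [j _ hj]; exists j => // k /= jk.
  rewrite ltNge; apply/negP => ZM.
  have := hj k jk; rewrite /= ltNge => /negP; apply.
  apply: (le_trans (hk k)); rewrite mulrAC.
  by apply: ler_pM => //; [exact: orbit_prod_ge0|exact: (hC k).1].
(* [F j] lies in the event for the single index [k = j], which tightness bounds uniformly in [j];
   the increasing union keeps the bound. *)
have PF : (P (\bigcup_j F j) <= e%:E)%E.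
  apply: measure_nd_bigcup_le => //.
    move=> i j ij; apply/subsetPset => w hw k /= jk; apply: hw; exact: leq_trans ij jk.
  move=> j; rewrite (splitr e) EFinD.
  apply: (le_trans _ (leeD (hM1 (n - j%:Z)) (hM2 (n - j%:Z)))).
  have mX' := measurable_norm_gt X mX (n - j%:Z) M1%:R.
  have mY' := measurable_norm_gt Y mY (n - j%:Z) M2%:R.
  apply: (le_trans _ (measureU2 _ mX' mY')).
  apply: le_measure; rewrite ?inE//; first exact: measurableU.
  move=> w /(_ j (leqnn j)) /= h; apply: contrapT => /not_orP[/negP h1 /negP h2].
  move: h h1 h2; rewrite -!leNgt /M => h h1 h2.
  by have := ler_normB (X (n - j%:Z) w) (Y (n - j%:Z) w); lra.
have mUF : measurable (\bigcup_j F j) by exact: bigcupT_measurable.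
apply: (@le_trans _ _ (P (N `|` \bigcup_j F j))).
  by apply: le_measure; rewrite ?inE//; exact: measurableU.
apply: (le_trans (measureU2 _ mN mUF)); rewrite -(add0e e%:E).
by apply: leeD => //; rewrite le_eqVlt; apply/orP; left; apply/eqP.
Qed.

End Uniqueness.
End StationarySolution.

Theorem theorem2 (d : measure_display) (T : measurableType d) (R : realType)
  (P : probability T R) (A B : int -> T -> R) :
  (forall n, measurable_fun setT (A n)) ->
  (forall n, measurable_fun setT (B n)) ->
  stationary2 P A B ->
  ergodic2 P A B ->
  (* E[log|A_n|] is well defined (finite positive part) and negative *)
  (forall n, (\int[P]_w (logplus_abs (A n w))%:E < +oo)%E) ->
  (forall n, (\int[P]_w elogabs (A n w) < 0)%E) ->
  (forall n, (\int[P]_w (logplus_abs (B n w))%:E < +oo)%E) ->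
  (exists X : int -> T -> R, stationary_solution P A B X) /\
  (forall X Y : int -> T -> R,
     stationary_solution P A B X -> stationary_solution P A B Y ->
     {ae P, forall w, forall n, X n w = Y n w}).
Proof.
move=> mA mB AB_stat erg A_fin A_neg B_fin.
have [rho rho01 decay] :=
  ae_geometric_decay P A B mA mB AB_stat erg (A_fin 0) (A_neg 0) (B_fin 0).
split; first exact: stationary_solution_exists AB_stat _ rho01 decay.
move=> X Y solX solY; apply: ae_forall_int => n.
exact: solution_eq AB_stat _ rho01 decay _ _ solX solY n.
Qed.
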